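(* Let $X$ be an irreducible Markov chain with transition matrix $P$ and stationary distribution $\mu$ on the finite connected graph $G=(V,E)$. Let $a\in V$ and let $B\subset V$ be non-empty with $a\notin B$. Let $v_x$ be the expected number of visits to vertex $x$ before the first hitting of $B$, for the chain started from $a$. Consider the reversed network of the chain, with potential $0$ on all vertices of $B$, a fixed potential $\hat u_a$ at $a$, and all vertices outside $\{a\}\cup B$ free. Then there is a unique value of $\hat u_a$ for which the incoming current at $a$ is $\hat i_a=\sum_{y\sim a}\hat i_{ay}=1$, namely $\hat u_a=v_a/\mu_a$, and with this value the resulting potentials $\hat u_\cdot$ and currents $\hat i_{\cdot\cdot}$ satisfy $$\hat u_x=\frac{v_x}{\mu_x}\quad\text{for all }x\in V,\qquad \hat i_{xy}=v_xP_{xy}-v_yP_{yx}\quad\text{for all }x\sim y,$$ that is, $\hat i_{xy}$ is the expected number of jumps from $x$ to $y$ minus the expected number of jumps from $y$ to $x$ before absorption in $B$, for the chain started from $a$.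
   Context: Graphs are finite, connected and undirected, and loops are allowed; $x\sim y$ means that $x$ and $y$ are joined by an edge, with $x\sim x$ exactly when $x$ has a loop. A Markov chain on $G=(V,E)$ has $P_{xy}>0$ if and only if $x\sim y$; it need not be reversible. Here $v_x=\mathbf E_a\,\#\{0\le t<\tau_B^0: X(t)=x\}$ with $\tau^0_B=\inf\{t\ge0:X(t)\in B\}$, so $v_x=0$ for $x\in B$. The electric network associated with the chain has parameters $D_{xy}=D_{yx}=\sqrt{\mu_xP_{xy}\mu_yP_{yx}}$ and $\gamma_{xy}=1/\gamma_{yx}=\sqrt{\mu_xP_{xy}/(\mu_yP_{yx})}$ for $x\sim y$. The reversed network (the network associated with the reversed chain $\hat P_{xy}=P_{yx}\mu_y/\mu_x$) has parameters $\hat D_{xy}=D_{xy}$ and $\hat\gamma_{xy}=\gamma_{yx}=1/\gamma_{xy}$. In it, potentials $(\hat u_x)_{x\in V}$ and currents are related by $\hat i_{xy}=D_{xy}(\hat\gamma_{yx}\hat u_x-\hat\gamma_{xy}\hat u_y)$ for $x\sim y$, and a vertex $x$ is free if $\sum_{y\sim x}\hat i_{xy}=0$. For potentials prescribed on a nonempty set of vertices, with all others free, there is a unique solution. *)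

(* Defs.v *)
From HB Require Import structures.
From mathcomp Require Import all_boot all_order all_algebra.
From mathcomp Require Import all_classical all_reals all_analysis.
Set Implicit Arguments.
Unset Strict Implicit.
Unset Printing Implicit Defensive.
Import Order.TTheory GRing.Theory Num.Theory.
Import numFieldNormedType.Exports.
Local Open Scope classical_set_scope.
Local Open Scope ring_scope.

(* A graph is its adjacency relation; [e x x] means that [x] has a loop. *)
Definition connected_graph (V : finType) (e : rel V) : Prop :=
  symmetric e /\ forall x y, connect e x y.

Section Chain.
Variables (R : realType) (V : finType).
Implicit Types (P : V -> V -> R) (mu : V -> R) (e : rel V).

Definition stochastic P : Prop :=
  (forall x y, 0 <= P x y) /\ forall x, \sum_y P x y = 1.

Definition chain_on_graph e P : Prop := forall x y, (0 < P x y) = e x y.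

Fixpoint transition_power P (n : nat) (x y : V) : R :=
  if n is n'.+1 then \sum_z P x z * transition_power P n' z y else (x == y)%:R.

Definition irreducible_chain P : Prop :=
  forall x y, exists n, 0 < transition_power P n x y.

Definition stationary P mu : Prop :=
  [/\ forall x, 0 <= mu x, \sum_x mu x = 1 &
      forall y, \sum_x mu x * P x y = mu y].

Definition reversed_chain P mu : V -> V -> R :=
  fun x y => P y x * mu y / mu x.

(* The parameters are meaningful only on adjacent pairs. *)
Record network := Network { net_D : V -> V -> R; net_gamma : V -> V -> R }.

Definition network_of P mu : network :=
  Network (fun x y => Num.sqrt (mu x * P x y * (mu y * P y x)))
          (fun x y => Num.sqrt (mu x * P x y / (mu y * P y x))).

Definition reversed_network P mu : network :=
  network_of (reversed_chain P mu) mu.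

Definition current (N : network) (u : V -> R) (x y : V) : R :=
  net_D N x y * (net_gamma N y x * u x - net_gamma N x y * u y).

Definition incoming_current e N u x : R := \sum_(y | e x y) current N u x y.

Definition free_vertex e N u x : Prop := incoming_current e N u x = 0.

Definition potentials e N (a : V) (B : {set V}) (c : R) (u : V -> R) : Prop :=
  [/\ u a = c, forall x, x \in B -> u x = 0 &
      forall x, x != a -> x \notin B -> free_vertex e N u x].

Lemma reversed_networkE P mu x y : (forall z, mu z != 0) ->
  net_D (reversed_network P mu) x y = net_D (network_of P mu) x y /\
  net_gamma (reversed_network P mu) x y = net_gamma (network_of P mu) y x.
Proof.
move=> mu0; rewrite /= /reversed_chain.
have muK u v : mu u * (P v u * mu v / mu u) = mu v * P v u.
  by rewrite mulrC divfK ?mu0 // mulrC.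
by rewrite !muK; split=> //; rewrite mulrC.
Qed.

End Chain.

Section Process.
Context {R : realType} {V : finType} {d : measure_display}
  {T : measurableType d}.
Variable Pr : probability T R.
Implicit Types (X : nat -> T -> V) (B : {set V}).

(* The Markov property, with the conditional probability
   Pr(X_{t+1} = y | X_0 = h 0, ..., X_t = h t) = P (h t) y multiplied out. *)
Definition markov_chain (P : V -> V -> R) (a : V) X : Prop :=
  [/\ forall t x, measurable [set w | X t w = x],
      Pr [set w | X 0%N w = a] = 1%:E &
      forall (t : nat) (h : nat -> V) (y : V),
        (Pr [set w | (forall s, (s <= t)%N -> X s w = h s) /\ X t.+1 w = y] =
         Pr [set w | forall s, (s <= t)%N -> X s w = h s] * (P (h t) y)%:E)%E].

(* [+oo] when [B] is never hit *)
Definition hitting_time X B (w : T) : \bar R :=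
  ereal_inf [set (t%:R)%:E | t in [set t | X t w \in B]].

Definition expected_visits X B (x : V) : \bar R :=
  (\int[Pr]_w counting
     [set t : nat | (t%:R%:E < hitting_time X B w)%E /\ X t w = x])%E.

Definition expected_jumps X B (x y : V) : \bar R :=
  (\int[Pr]_w counting
     [set t : nat | [/\ (t%:R%:E < hitting_time X B w)%E,
                        X t w = x & X t.+1 w = y]])%E.

End Process.

(* Main.v *)
Require Import Defs.
From HB Require Import structures.
From mathcomp Require Import all_boot all_order all_algebra.
From mathcomp Require Import all_classical all_reals all_analysis.
From mathcomp Require Import measurable_realfun.
Set Implicit Arguments.
Unset Strict Implicit.
Unset Printing Implicit Defensive.
Import Order.TTheory GRing.Theory Num.Theory.
Import numFieldNormedType.Exports.
Local Open Scope classical_set_scope.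
Local Open Scope ring_scope.

(** In the reversed network the current along an edge is
    mu_x u_x P_xy - mu_y u_y P_yx.  In terms of w = mu u, the current out of x
    is therefore w_x - sum_y w_y P_yx, so vertices being free outside a and B
    says that w satisfies the first-step equation
      w = 0 on B,   w_x = c 1_{x = a} + sum_y w_y P_yx outside B,
    where c is the current entering at a ([potentials_flow]).  The expected
    numbers of visits v solve this equation with c = 1: the first visit to a
    is the start, and every later visit to x is a jump from some y
    ([green_flow]).

    The solution is unique given c ([absorbed_flow_unique]), so every
    potential satisfies mu u = c v.  Prescribing c = 1 gives u = v / mu;
    conversely, prescribing u_a = v_a / mu_a forces c = 1, because v_a >= 1.
    The formula for the currents follows by substitution, and its
    interpretation by jumps because the Markov property gives v_x P_xy
    expected jumps from x to y ([expected_jumpsE]).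

    Finiteness of v and uniqueness both come from one function h >= 0 with
    1 + sum_(y notin B) P_xy h_y <= h_x outside B ([lyapunov_exists]).
    The killed chain loses at least its current mass from the h-weighted mass
    at each step, so its total mass over time is at most h_a.  The
    difference z of two solutions satisfies |z| <= |z| P, and weighting by h
    gives sum |z| h <= sum |z| h - sum |z|. *)

(** * Positivity of the stationary distribution *)

Section StationaryMeasure.
Variables (R : realType) (V : finType) (P : V -> V -> R).
Hypothesis hP : stochastic P.

Lemma transition_power_ge0 n x y : 0 <= transition_power P n x y.
Proof.
case: hP => P0 _; elim: n x => [|n IH] x /=; first exact: ler0n.
by apply: sumr_ge0 => z _; rewrite mulr_ge0.
Qed.

Lemma stationary_transition_power mu n y :
  stationary P mu -> \sum_x mu x * transition_power P n x y = mu y.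
Proof.
move=> [_ _ st]; elim: n => [|n IH] /=.
  rewrite (bigD1 y)//= eqxx mulr1 big1 ?addr0// => x /negbTE ->.
  by rewrite mulr0.
under eq_bigr do rewrite mulr_sumr.
rewrite exchange_big /= -[RHS]IH; apply: eq_bigr => z _.
by rewrite -[in RHS]st mulr_suml; apply: eq_bigr => x _; rewrite mulrA.
Qed.

Lemma stationary_gt0 mu x :
  irreducible_chain P -> stationary P mu -> 0 < mu x.
Proof.
move=> irr hmu; have [mu0 mu1 _] := hmu.
have [z zgt0] : exists z, 0 < mu z.
  apply: contrapT => /forallNP no; have : \sum_z mu z = 0.
    apply: big1 => z _; apply/eqP; rewrite eq_le mu0 andbT leNgt.
    exact/negP/no.
  by rewrite mu1 => /eqP; rewrite oner_eq0.
have [n Pn] := irr z x.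
rewrite -(stationary_transition_power n x hmu).
apply: lt_le_trans (_ : mu z * transition_power P n z x <= _).
  exact: mulr_gt0.
rewrite (bigD1 z)//= lerDl sumr_ge0// => y _.
by rewrite mulr_ge0// transition_power_ge0.
Qed.

End StationaryMeasure.

(** * The chain killed on a set *)

Section KilledChain.
Variables (R : realType) (V : finType) (P : V -> V -> R) (B : {set V}).
Hypothesis hP : stochastic P.

Let P0 x y : 0 <= P x y. Proof. by case: hP. Qed.
Let P1 x : \sum_y P x y = 1. Proof. by case: hP. Qed.

(** The probability that the chain started at [x] avoids [B] at all times up to
    and including [n]. *)
Fixpoint survival (n : nat) (x : V) : R :=
  if x \in B then 0
  else if n is n'.+1 then \sum_y P x y * survival n' y else 1.

Lemma survival_absorbed n x : x \in B -> survival n x = 0.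
Proof. by case: n => [|n] /= ->. Qed.

Lemma survivalS n x :
  x \notin B -> survival n.+1 x = \sum_y P x y * survival n y.
Proof. by move=> /= /negbTE ->. Qed.

Lemma survival_ge0 n x : 0 <= survival n x.
Proof.
elim: n x => [|n IH] x /=; case: ifP => // _.
by apply: sumr_ge0 => y _; rewrite mulr_ge0.
Qed.

Lemma survival_le1 n x : survival n x <= 1.
Proof.
elim: n x => [|n IH] x /=; case: ifP => // _.
by rewrite -(P1 x); apply: ler_sum => y _; rewrite ler_piMr.
Qed.

Lemma survival_nonincreasing m n x :
  (m <= n)%N -> survival n x <= survival m x.
Proof.
have step k y : survival k.+1 y <= survival k y.
  elim: k y => [|k IH] y.
    have [yB|yB] := boolP (y \in B); first by rewrite !survival_absorbed.
    by rewrite [leRHS]/= (negbTE yB) survival_le1.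
  have [yB|yB] := boolP (y \in B); first by rewrite !survival_absorbed.
  by rewrite !survivalS//; apply: ler_sum => z _; rewrite ler_wpM2l.
elim: n => [|n IH]; first by rewrite leqn0 => /eqP ->.
rewrite leq_eqVlt => /predU1P[-> //|]; rewrite ltnS => /IH.
exact: le_trans.
Qed.

(** Being at [b] at time [n] and having avoided [B] until then are disjoint
    events. *)
Lemma survival_transition_power n x b :
  b \in B -> transition_power P n x b + survival n x <= 1.
Proof.
move=> bB; elim: n x => [|n IH] x /=; case: ifP => xB.
- by rewrite addr0; case: eqP.
- by case: eqP => [xb|_]; [rewrite xb bB in xB|rewrite add0r].
- rewrite addr0 -(P1 x); apply: ler_sum => y _; rewrite ler_piMr//.
  by apply: le_trans (IH y); rewrite lerDl survival_ge0.
- rewrite -big_split -(P1 x) /=; apply: ler_sum => y _.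
  by rewrite -mulrDr ler_piMr.
Qed.

Lemma survival_lt1 : irreducible_chain P -> B != finset.set0 ->
  exists n, forall x, survival n x < 1.
Proof.
move=> irr /set0Pn[b bB].
have [N hN] : exists N : V -> nat, forall x, survival (N x) x < 1.
  suff /choice[N hN] : forall x, exists n, survival n x < 1 by exists N.
  move=> x; have [n Pn] := irr x b; exists n.
  by apply: lt_le_trans (survival_transition_power n x bB); rewrite ltrDr.
exists (\max_x N x)%N => x; apply: le_lt_trans (hN x).
exact/survival_nonincreasing/leq_bigmax.
Qed.

(** A supersolution of the equation for the expected hitting time of [B]. *)
Definition lyapunov (h : V -> R) : Prop :=
  (forall x, 0 <= h x) /\
  forall x, x \notin B -> 1 + \sum_(y | y \notin B) P x y * h y <= h x.

(** Choose [n] and [eps] such that from every vertex [B] is hit by time [n] with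
    probability at least [eps].  The function sum_(k < n) survival k / eps
    works: applying the killed kernel shifts the sum by one step, which
    telescopes to a loss of (1 - survival n x) / eps, at least 1. *)
Lemma lyapunov_exists : irreducible_chain P -> B != finset.set0 ->
  exists h, lyapunov h.
Proof.
move=> irr B0; have [n sn] := survival_lt1 irr B0.
have [eps eps0 heps] : exists2 eps : R, 0 < eps &
    forall x, eps <= 1 - survival n x.
  exists (\big[Order.min/1]_x (1 - survival n x)) => [|x].
    apply/bigmin_gtP; split=> [|x _]; first exact: ltr01.
    by rewrite subr_gt0.
  exact: bigmin_le.
exists (fun x => (\sum_(0 <= k < n) survival k x) / eps); split=> [x|x xB].
  by apply: divr_ge0 (ltW eps0); apply: sumr_ge0 => k _; exact: survival_ge0.
have -> : \sum_(y | y \notin B) P x y * ((\sum_(0 <= k < n) survival k y) / eps)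
    = (\sum_(0 <= k < n) survival k.+1 x) / eps.
  under eq_bigr do rewrite mulrA mulr_sumr.
  rewrite -mulr_suml exchange_big /=; congr (_ / _).
  apply: eq_bigr => k _; rewrite (negbTE xB) big_mkcond.
  apply: eq_bigr => y _; case: ifPn => // /negPn yB.
  by rewrite survival_absorbed ?mulr0.
rewrite -lerBrDr -mulrBl ler_pdivlMr// mul1r; apply: le_trans (heps x) _.
rewrite -sumrB -(opprK (\sum_(_ <= _ < _) _)) -sumrN.
under eq_bigr do rewrite opprB.
by rewrite telescope_sumr// opprB lerB//= (negbTE xB).
Qed.

(** The balance equation of the killed chain fed by the source [f]: the mass [w]
    at a vertex outside [B] is its supply plus what arrives in one step. *)
Definition absorbed_flow (f w : V -> R) : Prop :=
  (forall x, x \in B -> w x = 0) /\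
  (forall x, x \notin B -> w x = f x + \sum_y w y * P y x).

(** A maximum principle in the L1 form: the difference of two solutions is
    dominated by its image under the killed kernel, whose norm weighted by a
    Lyapunov function is strictly smaller than that of the difference, unless
    the difference vanishes. *)
Lemma absorbed_flow_unique f w w' : irreducible_chain P -> B != finset.set0 ->
  absorbed_flow f w -> absorbed_flow f w' -> w =1 w'.
Proof.
move=> irr B0 [wB wf] [wB' wf'].
have [h [h0 hh]] := lyapunov_exists irr B0.
pose z x := w x - w' x.
have zB x : x \in B -> z x = 0 by move=> xB; rewrite /z wB// wB'// subrr.
have z_eq x : x \notin B -> z x = \sum_y z y * P y x.
  move=> xB; rewrite /z wf// wf'// opprD addrACA subrr add0r -sumrB.
  by apply: eq_bigr => y _; rewrite -mulrBl.
have key : \sum_(x | x \notin B) `|z x| * h x <=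
    \sum_(x | x \notin B) `|z x| * h x - \sum_(x | x \notin B) `|z x|.
  have zh : \sum_(x | x \notin B) `|z x| * h x <=
      \sum_(x | x \notin B) (\sum_(y | y \notin B) `|z y| * P y x) * h x.
    apply: ler_sum => x xB; rewrite ler_wpM2r// {1}z_eq//.
    apply: le_trans (ler_norm_sum _ _ _) _; rewrite [leRHS]big_mkcond.
    apply: ler_sum => y _; case: ifPn => [_|/negPn /zB ->].
      by rewrite normrM (ger0_norm (P0 _ _)).
    by rewrite mul0r normr0.
  apply: le_trans zh _; under eq_bigr do rewrite mulr_suml.
  rewrite exchange_big -sumrB /=; apply: ler_sum => y yB.
  under eq_bigr do rewrite -mulrA.
  by rewrite -mulr_sumr lerBrDl -{1}[`|z y|]mulr1 -mulrDr ler_wpM2l// hh.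
have /eqP : \sum_(x | x \notin B) `|z x| = 0.
  apply/eqP; rewrite eq_le sumr_ge0 ?andbT => [|x _]; last exact: normr_ge0.
  by move: key; rewrite lerBrDl gerDr.
rewrite psumr_eq0 => [/allP z0 x|x _]; last exact: normr_ge0.
have [xB|xB] := boolP (x \in B); first by rewrite wB// wB'.
have := z0 x (mem_index_enum x); rewrite xB normr_eq0 subr_eq0.
by move=> /eqP.
Qed.

Section Green.
Variable a : V.

(** The law at time [t] of the chain started at [a], restricted to the event
    that [B] has not been hit up to and including time [t]. *)
Fixpoint killed_law (t : nat) (x : V) : R :=
  if x \in B then 0
  else if t is t'.+1 then \sum_y killed_law t' y * P y x else (x == a)%:R.

Lemma killed_law_absorbed t x : x \in B -> killed_law t x = 0.
Proof. by case: t => [|t] /= ->. Qed.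

Lemma killed_lawS t x :
  x \notin B -> killed_law t.+1 x = \sum_y killed_law t y * P y x.
Proof. by move=> /= /negbTE ->. Qed.

Lemma killed_law_ge0 t x : 0 <= killed_law t x.
Proof.
elim: t x => [|t IH] x /=; case: ifP => // _.
by apply: sumr_ge0 => y _; rewrite mulr_ge0.
Qed.

(** In one step the [h]-weighted mass decreases by at least the mass present; the
    decreases sum to at most the initial weight. *)
Lemma killed_law_lyapunov h n : lyapunov h ->
  \sum_(t < n) \sum_x killed_law t x + \sum_x killed_law n x * h x <= h a.
Proof.
move=> [h0 hh]; elim: n => [|n IH].
  rewrite big_ord0 add0r (bigD1 a)//= big1 => [|x /negbTE ->].
    by rewrite addr0 eqxx; case: ifP => _; rewrite ?mul1r ?mul0r.
  by case: ifP; rewrite mul0r.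
apply: le_trans IH; rewrite big_ord_recr -addrA lerD2l /=.
have -> : \sum_x killed_law n.+1 x * h x =
    \sum_y killed_law n y * \sum_(x | x \notin B) P y x * h x.
  under [RHS]eq_bigr do rewrite mulr_sumr.
  rewrite [RHS]exchange_big [RHS]big_mkcond /=; apply: eq_bigr => x _.
  case: (x \in B) => /=; first by rewrite mul0r.
  by rewrite mulr_suml; apply: eq_bigr => y _; rewrite mulrA.
rewrite -big_split /=; apply: ler_sum => y _.
have [yB|yB] := boolP (y \in B).
  by rewrite killed_law_absorbed// !mul0r addr0.
by rewrite -[X in X + _]mulr1 -mulrDr ler_wpM2l ?killed_law_ge0// hh.
Qed.

(** The Green function of the killed chain, extended real valued until it is
    known to be finite. *)
Definition green (x : V) : \bar R := \sum_(t <oo) (killed_law t x)%:E.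

Lemma green_ge0 x : (0 <= green x)%E.
Proof. by apply: nneseries_ge0 => t _ _; rewrite lee_fin killed_law_ge0. Qed.

Lemma green_fin_num x : irreducible_chain P -> B != finset.set0 ->
  green x \is a fin_num.
Proof.
move=> irr B0; have [h hh] := lyapunov_exists irr B0.
rewrite ge0_fin_numE ?green_ge0//; apply: le_lt_trans (ltry (h a)).
apply: lime_le.
  by apply: is_cvg_nneseries => t _ _; rewrite lee_fin killed_law_ge0.
apply: nearW => n /=; rewrite sumEFin lee_fin big_mkord.
apply: le_trans (killed_law_lyapunov n hh).
rewrite -[leLHS]addr0 lerD//.
  apply: ler_sum => t _; rewrite (bigD1 x)//= lerDl sumr_ge0// => y _.
  exact: killed_law_ge0.
by apply: sumr_ge0 => y _; rewrite mulr_ge0 ?killed_law_ge0//; case: hh.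
Qed.

(** The source term is the mass at time 0; the mass at each later time is the
    one-step image of the preceding one. *)
Lemma green_flow : irreducible_chain P -> B != finset.set0 ->
  absorbed_flow (fun x => (x == a)%:R) (fun x => fine (green x)).
Proof.
move=> irr B0; have gfin x := green_fin_num x irr B0.
split=> x xB.
  by rewrite /green eseries0// => t _ _; rewrite killed_law_absorbed.
apply: EFin_inj; rewrite fineK// EFinD -sumEFin.
under eq_bigr do rewrite EFinM fineK// muleC.
rewrite /green nneseries_recl//; last first.
  by move=> t _; rewrite lee_fin killed_law_ge0.
congr (_ + _)%E; first by rewrite /= (negbTE xB).
rewrite -(nneseries_addn (f := fun t => (killed_law t x)%:E)); last first.
  by move=> t; rewrite lee_fin killed_law_ge0.
under eq_eseriesr do rewrite addn1 killed_lawS// -sumEFin.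
rewrite nneseries_sum; last first.
  by move=> y t _; rewrite lee_fin mulr_ge0// killed_law_ge0.
apply: eq_bigr => y _; rewrite -nneseriesZl; last first.
  by move=> t _; rewrite lee_fin killed_law_ge0.
by apply: eq_eseriesr => t _; rewrite EFinM muleC.
Qed.

End Green.

End KilledChain.
(** * Expected visits and jumps of the process *)

Section Occupation.
Context {R : realType} {V : finType} {d : measure_display}
  {T : measurableType d}.
Variables (Pr : probability T R) (P : V -> V -> R) (a : V)
  (X : nat -> T -> V) (B : {set V}).

Lemma total_probability (I : finType) (Z : T -> I) (A : set T) :
  (forall i, measurable [set w | Z w = i]) -> measurable A ->
  Pr A = (\sum_i Pr (A `&` [set w | Z w = i]))%E.
Proof.
move=> mZ mA; rewrite fsbig_seq ?index_enum_uniq// -measure_fin_bigcup.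
- congr (Pr _); apply/seteqP; split=> w; last by move=> [i _ []].
  by move=> Aw; exists (Z w) => //=; rewrite mem_index_enum.
- exact: finite_seq.
- by move=> i j _ _ [w [[_ /= <-] [_ /= <-]]].
- by move=> i _; exact: measurableI.
Qed.

Hypothesis hX : markov_chain Pr P a X.

Let mX t x : measurable [set w | X t w = x]. Proof. by case: hX. Qed.

(** The trajectory up to time [t] as a point of a finite type, so that events of
    the past are finite disjoint unions of cylinders. *)
Definition history (t : nat) (w : T) : {ffun 'I_t.+1 -> V} :=
  [ffun s : 'I_t.+1 => X s w].

Lemma history_eqE t (f : {ffun 'I_t.+1 -> V}) :
  [set w | history t w = f] =
  [set w | forall s, (s <= t)%N -> X s w = f (inord s)].
Proof.
apply/seteqP; split=> w /=.
  by move=> <- s st; rewrite ffunE inordK.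
move=> Xf; apply/ffunP => i; rewrite ffunE Xf; first by rewrite inord_val.
by rewrite -ltnS.
Qed.

Lemma measurable_history t (f : {ffun 'I_t.+1 -> V}) :
  measurable [set w | history t w = f].
Proof.
rewrite history_eqE (_ : mkset _ =
  \bigcap_(s in [set s | (s <= t)%N]) [set w | X s w = f (inord s)])//.
by apply: bigcap_measurable; [exists 0%N | move=> s _; exact: mX].
Qed.

Lemma measurable_past t (F : pred {ffun 'I_t.+1 -> V}) :
  measurable [set w | F (history t w)].
Proof.
rewrite (_ : mkset _ = \bigcup_(f in [set f | F f]) [set w | history t w = f]).
  by apply: fin_bigcup_measurable => // f _; exact: measurable_history.
by apply/seteqP; split=> w /= => [Fw|[f Ff ->]//]; exists (history t w).
Qed.

(** The Markov property for a whole event of the past that determines the present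
    state: on each cylinder making up the event the jump probability is the
    same factor, which can be taken out of the sum. *)
Lemma markov_past t (F : pred {ffun 'I_t.+1 -> V}) x y :
  (forall f, F f -> f ord_max = x) ->
  (Pr [set w | F (history t w) /\ X t.+1 w = y] =
   Pr [set w | F (history t w)] * (P x y)%:E)%E.
Proof.
move=> Fx; have [_ _ mk] := hX.
rewrite (total_probability (Z := history t)); first last.
- exact: measurableI (measurable_past F) (mX _ _).
- exact: measurable_history.
rewrite [in RHS](total_probability (Z := history t)); first last.
- exact: measurable_past.
- exact: measurable_history.
rewrite ge0_sume_distrl; last by move=> f _; exact: measure_ge0.
apply: eq_bigr => f _.
have [Ff|nFf] := boolP (F f); last first.
  rewrite (_ : _ `&` _ = set0) ?measure0; last first.
    by apply/seteqP; split=> // w /= [[+ _] hw]; rewrite hw (negbTE nFf).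
  rewrite (_ : _ `&` _ = set0) ?measure0 ?mul0e//.
  by apply/seteqP; split=> // w /= [+ hw]; rewrite hw (negbTE nFf).
rewrite (_ : _ `&` _ =
  [set w | (forall s, (s <= t)%N -> X s w = f (inord s)) /\ X t.+1 w = y]);
  last first.
  apply/seteqP; split=> w /=.
    move=> [[_ Xy]] hw; split=> //.
    by have : [set w | history t w = f] w by []; rewrite history_eqE.
  move=> [hw Xy]; have : [set w | history t w = f] w by rewrite history_eqE.
  by move=> /= ->.
rewrite (_ : _ `&` _ =
  [set w | forall s, (s <= t)%N -> X s w = f (inord s)]); last first.
  by rewrite -history_eqE; apply/seteqP; split=> w /= => [[]//|->].
rewrite (mk t (fun s => f (inord s)) y); congr (_ * (P _ _)%:E)%E.
by rewrite -(Fx _ Ff); congr (f _); apply: val_inj; rewrite /= inordK.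
Qed.

Local Notation alive t w := ((t%:R : R)%:E < hitting_time X B w)%E.

(** The infimum defining the hitting time is over integers, so exceeding [t] means
    being at least [t + 1]. *)
Lemma lt_hitting_time t w :
  alive t w <-> forall s, (s <= t)%N -> X s w \notin B.
Proof.
split=> [tau s st|alive].
  apply/negP => sB; move: tau; apply/negP; rewrite -leNgt.
  apply: ge_ereal_inf; exists s%:R%:E; last by rewrite lee_fin ler_nat.
  by exists s.
apply: lt_le_trans (_ : t.+1%:R%:E <= _)%E; first by rewrite lte_fin ltr_nat.
apply: le_ereal_inf_tmp => _ [s /= sB <-]; rewrite lee_fin ler_nat ltnNge.
by apply/negP => st; move: sB; apply/negP; exact: alive.
Qed.

Definition alive_at t x : pred {ffun 'I_t.+1 -> V} :=
  fun f => [forall s, f s \notin B] && (f ord_max == x).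

Lemma alive_atE t x w : alive_at x (history t w) <->
  alive t w /\ X t w = x.
Proof.
rewrite lt_hitting_time /alive_at; split.
  move=> /andP[/forallP al /eqP]; rewrite ffunE => Xx; split=> // s st.
  by have := al (inord s); rewrite ffunE inordK.
move=> [al Xx]; rewrite ffunE Xx eqxx andbT.
by apply/forallP => s; rewrite ffunE; apply: al; rewrite -ltnS.
Qed.

Lemma probability_jump_killed t x y :
  (Pr [set w | [/\ alive t w, X t w = x & X t.+1 w = y]] =
   Pr [set w | alive t w /\ X t w = x] * (P x y)%:E)%E.
Proof.
rewrite [X in Pr X = _](_ : _ =
  [set w | alive_at x (history t w) /\ X t.+1 w = y]); last first.
  apply/seteqP; split=> w /= => [[? ? ?]|[/alive_atE[]]] //.
  by split=> //; apply/alive_atE.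
rewrite [X in _ = (Pr X * _)%E](_ : _ = [set w | alive_at x (history t w)]).
  by apply: markov_past => f /andP[_ /eqP].
by apply/seteqP; split=> w /= /alive_atE.
Qed.

(** The events of being alive at [x] follow the recursion of the killed law, by
    splitting according to the preceding position. *)
Lemma probability_killed t x :
  (Pr [set w | alive t w /\ X t w = x] =
   (killed_law P B a t x)%:E)%E.
Proof.
have [xB|xB] := boolP (x \in B).
  rewrite killed_law_absorbed// (_ : mkset _ = set0) ?measure0//.
  apply/seteqP; split=> // w /= [/lt_hitting_time/(_ t (leqnn t)) + Xx].
  by rewrite Xx xB.
elim: t x xB => [|t IH] x xB.
  rewrite /= (negbTE xB) (_ : mkset _ = [set w | X 0%N w = x]); last first.
    apply/seteqP; split=> w /= => [[]//|Xx]; split=> //; apply/lt_hitting_time.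
    by move=> s; rewrite leqn0 => /eqP ->; rewrite Xx.
  have [_ X0 _] := hX.
  have [->|xa] := eqVneq x a; first by rewrite X0.
  apply/eqP; rewrite eq_le measure_ge0 andbT.
  have -> : 0%:E = Pr (~` [set w | X 0%N w = a]).
    by rewrite probability_setC// X0 subee.
  apply: le_measure; rewrite ?inE//; first exact: measurableC.
  by move=> w /= -> /eqP; rewrite (negbTE xa).
rewrite killed_lawS//.
rewrite (total_probability (Z := X t)); [|exact: mX|]; last first.
  rewrite (_ : mkset _ = [set w | alive_at x (history t.+1 w)]).
    exact: measurable_past.
  by apply/seteqP; split=> w /= /alive_atE.
rewrite -sumEFin; apply: eq_bigr => y _.
rewrite EFinM; have [yB|yB] := boolP (y \in B).
  rewrite killed_law_absorbed// mul0e (_ : _ `&` _ = set0) ?measure0//.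
  apply/seteqP; split=> // w /= [[/lt_hitting_time/(_ t (leqnSn t)) + _] Xy].
  by rewrite Xy yB.
rewrite -IH// -probability_jump_killed; congr (Pr _).
apply/seteqP; split=> w /=.
  move=> [[/lt_hitting_time al Xx] Xy]; split=> //; apply/lt_hitting_time.
  by move=> s st; apply: al; apply: leqW.
move=> [/lt_hitting_time al Xy Xx]; split=> //; split=> //.
apply/lt_hitting_time => s; rewrite leq_eqVlt => /predU1P[->|].
  by rewrite Xx.
by rewrite ltnS => /al.
Qed.

(** A count of occurrence times is a series of indicators, integrated term by
    term. *)
Lemma expectation_count (A : nat -> set T) : (forall t, measurable (A t)) ->
  (\int[Pr]_w counting [set t | A t w] = \sum_(t <oo) Pr (A t))%E.
Proof.
move=> mA; have diracA t w : \d_t [set t | A t w] = (\1_(A t) w)%:E :> \bar R.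
  by rewrite diracE indicE; congr (_%:R%:E); apply/idP/idP; rewrite !inE.
under eq_integral.
  move=> w _; rewrite counting_dirac; under eq_eseriesr do rewrite diracA.
  over.
rewrite integral_nneseries//; last first.
  by move=> t; exact/measurable_EFinP/measurable_indic.
by apply: eq_eseriesr => t _; rewrite integral_indic// setIT.
Qed.

Lemma expected_visitsE x : expected_visits Pr X B x = green P B a x.
Proof.
rewrite /expected_visits (expectation_count
  (A := fun t => [set w | alive t w /\ X t w = x])).
  by apply: eq_eseriesr => t _; exact: probability_killed.
move=> t; rewrite (_ : mkset _ = [set w | alive_at x (history t w)]).
  exact: measurable_past.
by apply/seteqP; split=> w /= /alive_atE.
Qed.

Lemma expected_jumpsE x y :
  expected_jumps Pr X B x y = (green P B a x * (P x y)%:E)%E.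
Proof.
rewrite /expected_jumps (expectation_count (A := fun t =>
  [set w | [/\ alive t w, X t w = x & X t.+1 w = y]])).
  rewrite muleC -nneseriesZl; last first.
    move=> t _; rewrite -probability_killed; exact: measure_ge0.
  apply: eq_eseriesr => t _.
  by rewrite probability_jump_killed probability_killed muleC.
move=> t; rewrite (_ : mkset _ =
    [set w | alive_at x (history t w)] `&` [set w | X t.+1 w = y]).
  exact: measurableI (measurable_past _) (mX _ _).
apply/seteqP; split=> w /= => [[? ? ?]|[/alive_atE[]]] //.
by split=> //; apply/alive_atE.
Qed.

End Occupation.
(** * Potentials on the reversed network *)

Section ReversedNetwork.
Variables (R : realType) (V : finType) (e : rel V).
Variables (P : V -> V -> R) (mu : V -> R).
Hypotheses (hG : connected_graph e) (hP : stochastic P)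
  (hPe : chain_on_graph e P) (mu_gt0 : forall x, 0 < mu x).

(** The conductance and the asymmetry factor are the square roots of the product
    and of the quotient of the two edge flows mu_x P_xy and mu_y P_yx, so
    their products are these flows. *)
Lemma reversed_current u x y : e x y ->
  current (reversed_network P mu) u x y =
  mu x * u x * P x y - mu y * u y * P y x.
Proof.
move=> exy; have eyx : e y x by case: hG => <-.
have [p q] : 0 < P x y /\ 0 < P y x by rewrite !hPe.
have mu0 z : mu z != 0 by rewrite gt_eqF.
rewrite /current.
have [-> ->] := reversed_networkE P x y mu0.
have [_ ->] := reversed_networkE P y x mu0.
have sqrtMV (s t : R) : 0 < s -> 0 < t ->
    Num.sqrt (s * t) * Num.sqrt (s / t) = s.
  move=> s0 t0; rewrite -sqrtrM ?mulr_ge0 ?ltW// mulrACA divff ?gt_eqF//.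
  by rewrite mulr1 -expr2 sqrtr_sqr gtr0_norm.
rewrite /= mulrBr (mulrAC (mu x) (u x)) (mulrAC (mu y) (u y)).
have : 0 < mu x * P x y by exact: mulr_gt0.
have : 0 < mu y * P y x by exact: mulr_gt0.
move: (mu x * P x y) (mu y * P y x) => s t t0 s0.
by rewrite !(mulrA (Num.sqrt _)) sqrtMV// (mulrC s t) sqrtMV.
Qed.

(** Off the edges of the graph both transition probabilities vanish, so the sum
    extends to all vertices. *)
Lemma reversed_incoming_current u x :
  incoming_current e (reversed_network P mu) u x =
  mu x * u x - \sum_y mu y * u y * P y x.
Proof.
case: hP hG => P0 P1 [se _].
have -> : mu x * u x = \sum_y mu x * u x * P x y by rewrite -mulr_sumr P1 mulr1.
rewrite -sumrB /incoming_current big_mkcond; apply: eq_bigr => y _.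
case: ifPn => [/reversed_current //|nexy].
have PE z t : ~~ e z t -> P z t = 0.
  by rewrite -hPe -leNgt => Pzt; apply/eqP; rewrite eq_le Pzt P0.
by rewrite !PE ?mulr0 ?subrr// se.
Qed.

(** Free vertices satisfy the homogeneous balance equation, and at [a] the balance
    equation defines the incoming current. *)
Lemma potentials_flow a (B : {set V}) c u : a \notin B ->
  potentials e (reversed_network P mu) a B c u <->
  u a = c /\ absorbed_flow P B
    (fun x => (x == a)%:R * incoming_current e (reversed_network P mu) u a)
    (fun x => mu x * u x).
Proof.
move=> aB; split=> [[ua uB fr]|[ua [wB wf]]].
  split=> //; split=> [x xB|x xB]; first by rewrite uB// mulr0.
  have [->|xa] := eqVneq x a; last first.
    have := fr x xa xB; rewrite /free_vertex reversed_incoming_current.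
    by move=> /subr0_eq ->; rewrite mul0r add0r.
  by rewrite mul1r reversed_incoming_current subrK.
split=> // [x xB|x xa xB].
  by have /eqP := wB x xB; rewrite mulf_eq0 gt_eqF//= => /eqP.
rewrite /free_vertex reversed_incoming_current [X in X - _]wf//.
by rewrite (negbTE xa) mul0r add0r subrr.
Qed.

End ReversedNetwork.

(** * Visits before absorption as potentials *)

Theorem mainTheorem11 (R : realType) (V : finType) (e : rel V)
    (P : V -> V -> R) (mu : V -> R)
    (d : measure_display) (T : measurableType d) (Pr : probability T R)
    (X : nat -> T -> V) (a : V) (B : {set V})
    (hG : connected_graph e)
    (hP : stochastic P) (hPe : chain_on_graph e P)
    (hirr : irreducible_chain P) (hmu : stationary P mu)
    (hX : markov_chain Pr P a X)
    (hB : B != finset.set0) (ha : a \notin B) :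
  let N := reversed_network P mu in
  let v := fun x => fine (expected_visits Pr X B x) in
  let J := fun x y => fine (expected_jumps Pr X B x y) in
  [/\ forall x, expected_visits Pr X B x \is a fin_num,
      forall x y, expected_jumps Pr X B x y \is a fin_num,
      unique (fun c => exists u, potentials e N a B c u /\
                                 incoming_current e N u a = 1)
             (v a / mu a) &
      forall u, potentials e N a B (v a / mu a) u ->
        [/\ forall x, u x = v x / mu x,
            forall x y, e x y ->
              current N u x y = v x * P x y - v y * P y x &
            forall x y, e x y -> current N u x y = J x y - J y x]].

Proof.
move=> N v J.
have mu_gt0 x : 0 < mu x by apply: stationary_gt0 hirr hmu.
have visE x : expected_visits Pr X B x = green P B a x.
  exact: expected_visitsE.
have P0 x y : 0 <= P x y by case: hP.
have gfin x := green_fin_num hP a x hirr hB.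
have vfin x : expected_visits Pr X B x \is a fin_num by rewrite visE.
have jmpE x y : expected_jumps Pr X B x y = (v x * P x y)%:E.
  by rewrite (expected_jumpsE _ hX)// EFinM fineK// visE.
have vflow : absorbed_flow P B (fun x => (x == a)%:R) v.
  have -> : v = fun x => fine (green P B a x).
    by apply/funext => x; rewrite /v visE.
  exact: green_flow.
have va_gt0 : 0 < v a.
  have [_ /(_ a ha) ->] := vflow; rewrite eqxx ltr_pwDl// sumr_ge0// => y _.
  by rewrite mulr_ge0// fine_ge0// visE green_ge0.
have flowE := @potentials_flow _ _ e P mu hG hP hPe mu_gt0 a B.
have muK x : mu x * (v x / mu x) = v x by rewrite mulrC divfK ?gt_eqF.
pose u0 x := v x / mu x.
have unit_current : incoming_current e N u0 a = 1.
  rewrite reversed_incoming_current// /u0; under eq_bigr do rewrite muK.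
  by rewrite muK; have [_ /(_ a ha) {1}->] := vflow; rewrite eqxx addrK.
(* By linearity the incoming current times [v] solves the same balance
   equation as [mu u]. *)
have proportional c u : potentials e N a B c u ->
    forall x, mu x * u x = incoming_current e N u a * v x.
  move=> /flowE-/(_ ha)[_ uflow].
  apply: (absorbed_flow_unique hP hirr hB uflow).
  have [vB vE] := vflow; split=> x xB; first by rewrite vB// mulr0.
  rewrite vE// mulrDr mulr_sumr; congr (_ + _); first by rewrite mulrC.
  by apply: eq_bigr => y _; rewrite mulrA.
split=> //.
- by move=> x y; rewrite jmpE.
- split.
    exists u0; split=> //; apply/flowE => //; split=> //.
    rewrite unit_current; have [vB vE] := vflow.
    split=> x xB; rewrite /u0 muK; first exact: vB.
    rewrite vE// mulr1; congr (_ + _).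
    by apply: eq_bigr => y _; rewrite muK.
  move=> c [u [pot cur]]; have [<- _ _] := pot.
  have := proportional _ _ pot a; rewrite cur mul1r => <-.
  by rewrite mulrC mulKf ?gt_eqF.
- move=> u pot; have prop := proportional _ _ pot; have [ua _ _] := pot.
  have cur : incoming_current e N u a = 1.
    have /esym/eqP := prop a; rewrite ua muK -{2}[v a]mul1r.
    by move=> /eqP/(mulIf (lt0r_neq0 va_gt0)).
  have muu x : mu x * u x = v x by rewrite prop cur mul1r.
  have curE x y : e x y -> current N u x y = v x * P x y - v y * P y x.
    by move=> exy; rewrite (reversed_current hG hPe)// !muu.
  split=> // [x|x y exy]; first by rewrite -muu mulrC mulKf ?gt_eqF.
  by rewrite /J !jmpE/= curE.
Qed.
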